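(* Let $f(n)$ denote the smallest positive integer such that every set of $f(n)$ points in general position in the plane contains the vertices of a convex $n$-gon. For integers $i \ge 4$ and $m,k \ge 4$ define $$w_4(m,k) = \binom{m+k-6}{k-2} + \binom{m+k-7}{k-3} + 2\binom{m+k-8}{k-4},$$ and for $i \ge 5$, $w_i(m,k) = 0$ if $k < i$ and $w_i(m,k) = (i-1)\binom{m+k-i-4}{k-i}$ if $k \ge i$. Let $g(m,l) = \sum_{i=4}^{\infty} w_i(m,l)$ (a finite sum). Then for every integer $n \ge 6$, $$f(n) \le \binom{2n-6}{n-3} + g(n,n-2) + 2.$$
   Context: General position means no three points are collinear. *)

(* Defs.v *)
From HB Require Import structures.
From mathcomp Require Import all_boot all_order all_algebra finmap.
From mathcomp Require Import interval_inference.
From mathcomp Require Import boolp classical_sets reals convex.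

Set Implicit Arguments.
Unset Strict Implicit.
Unset Printing Implicit Defensive.

Import Order.TTheory GRing.Theory Num.Theory.

Local Open Scope classical_set_scope.
Local Open Scope ring_scope.
Local Open Scope convex_scope.

Notation plane R := 'rV[R]_2.

Definition line (R : realType) (a v : plane R) : set (plane R) :=
  [set x | exists t : R, x = a + t *: v].

Definition collinear (R : realType) (p q r : plane R) : Prop :=
  exists a v : plane R,
    v != 0 /\ [/\ line a v p, line a v q & line a v r].

Definition general_position (R : realType) (X : {fset (plane R)}) : Prop :=
  forall p q r : plane R, p \in X -> q \in X -> r \in X ->
    p != q -> q != r -> p != r -> ~ collinear p q r.

Definition convex_hull (R : realType) (A : set (plane R)) : set (plane R) :=
  smallest (@convex_set R (plane R)) A.

(* The vertices of a convex polygon are its extreme points. *)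
Definition vertices (R : realType) (K : set (convex_lmodType (plane R))) :
    set (plane R) :=
  [set x | K x /\
    forall (a b : convex_lmodType (plane R)) (t : {i01 R}), K a -> K b ->
      0 < t%:num -> t%:num < 1 -> x = a <| t |> b -> a = x /\ b = x].

Definition convex_polygon (R : realType) (n : nat) (K : set (plane R)) : Prop :=
  exists V : {fset (plane R)},
    [/\ #|` V| = n, K = convex_hull [set` V] & vertices K = [set` V]].

Definition contains_convex_gon (R : realType) (n : nat) (X : {fset (plane R)})
    : Prop :=
  exists K : set (plane R), convex_polygon n K /\ vertices K `<=` [set` X].

Definition forces_convex_gon (R : realType) (n N : nat) : Prop :=
  forall X : {fset (plane R)}, #|` X| = N -> general_position X ->
    contains_convex_gon n X.

(* [is_f R n N] is the graph [N = f(n)]; it does not presuppose that f(n)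
   exists. *)
Definition is_f (R : realType) (n N : nat) : Prop :=
  [/\ (0 < N)%N, forces_convex_gon R n N &
      forall M : nat, (0 < M)%N -> forces_convex_gon R n M -> (N <= M)%N].

Lemma is_f_inj (R : realType) (n N M : nat) : is_f R n N -> is_f R n M -> N = M.
Proof.
move=> [N0 NF Nmin] [M0 MF Mmin].
by apply/eqP; rewrite eqn_leq Nmin// Mmin.
Qed.

(* Only meant for 4 <= i, 4 <= m and 4 <= k: no subtraction of natural numbers
   is then truncated. *)
Definition w (i m k : nat) : nat :=
  if i == 4%N then
    ('C(m + k - 6, k - 2) + 'C(m + k - 7, k - 3) + 2 * 'C(m + k - 8, k - 4))%N
  else if (k < i)%N then 0%N
  else ((i - 1) * 'C(m + k - i - 4, k - i))%N.

(* The sum over all i >= 4, whose terms with i > l vanish; see [g_stable]. *)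
Definition g (m l : nat) : nat := (\sum_(4 <= i < l.+1) w i m l)%N.

Lemma w_eq0 (i m k : nat) : (4 < i)%N -> (k < i)%N -> w i m k = 0%N.
Proof. by rewrite /w ltn_neqAle eq_sym => /andP[/negPf-> _] ->. Qed.

Lemma g_stable (m l N : nat) : (4 <= l)%N -> (l <= N)%N ->
  (\sum_(4 <= i < N.+1) w i m l)%N = g m l.
Proof.
move=> l4 lN; have l4' : (4 <= l.+1)%N by exact: leqW.
have lN' : (l.+1 <= N.+1)%N by [].
rewrite (big_cat_nat l4' lN') /= -[RHS]addn0; congr addn.
rewrite big_nat big1 // => i /andP[li _].
by apply: w_eq0 => //; exact: leq_ltn_trans li.
Qed.

(* Main.v *)
Require Import Defs.
From mathcomp Require Import all_boot all_order all_algebra reals zify ring lra.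

(* Let x be the lexicographically least point.  Order the other points by angle
   around x and call p < q < r a cup if it turns clockwise and a cap otherwise.
   The following are convex n-gons: x with a cap of n-1 points, a cup of n
   points, and a cup of n-1 points closed up by a point beyond its chord.

   Scanning from left to right, split the points other than x into a set G
   without cups of n-1 points and a set H each of whose points completes such a
   cup whose other points lie in G.  The cups-caps theorem bounds G by
   C(2n-6,n-3).  A cap starting at v in H extends to the left by the
   penultimate point of the cup that v completes, so H has no cap of n-2 points.
   Let H1 be the set of left ends of cups of n-1 points inside H.  Then H \ H1
   has at most C(2n-7,n-3) points.  The crucial fact is that H has no cap of n-4
   points ending in H1 (no_cap_into_cup), so that H1 has at most C(2n-8,n-6)
   points; here 6 <= n guarantees that such a cap has at least two points. *)

Set Implicit Arguments.
Unset Strict Implicit.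
Unset Printing Implicit Defensive.

Import Order.TTheory GRing.Theory Num.Theory.

(** * Cups and caps *)

Section Chains.
Variables (T : finType) (lt : rel T).
Hypotheses (lt_irr : irreflexive lt) (lt_tr : transitive lt)
  (lt_total : forall x y, x != y -> lt x y || lt y x).

(** Only consecutive triples are tested, so that chains sharing two points can be glued; [chain_nth]
    recovers all triples of a cup. *)
Fixpoint chain (c : T -> T -> T -> bool) (s : seq T) : bool :=
  if s is x :: s' then
    (if s' is y :: s'' then
       lt x y && (if s'' is z :: _ then c x y z else true)
     else true) && chain c s'
  else true.

Definition avoids c k (A : {set T}) :=
  forall s, size s = k -> {subset s <= A} -> ~~ chain c s.

Definition anti (c : T -> T -> T -> bool) x y z := ~~ c x y z.

Lemma avoidsS c k (A B : {set T}) : A \subset B -> avoids c k B -> avoids c k A.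
Proof. by move=> /subsetP AB cB s sk sA; apply: cB => // x /sA /AB. Qed.

Lemma chain_behead c x s : chain c (x :: s) -> chain c s.
Proof. by case: s => //= y s /andP[]. Qed.

Lemma chain_glue c s x y t :
  chain c (s ++ [:: x; y]) -> chain c [:: x, y & t] -> chain c (s ++ [:: x, y & t]).
Proof.
elim: s => // p s IHs; case: s IHs => [|q [|r s]] IHs.
- by move=> /= /andP[/andP[-> ->] _] ->.
- by move=> /= /andP[/andP[-> ->] h1] h2; have := IHs h1 h2.
- move=> /andP[/andP[pq pqr] h1] h2.
  by have := IHs h1 h2; rewrite /= pq pqr.
Qed.

Lemma chain_rcons2 c s x y z :
  chain c (rcons (rcons s x) y) -> lt y z -> c x y z ->
  chain c (rcons (rcons (rcons s x) y) z).
Proof.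
rewrite -!cats1 -!catA /= => h yz xyz; apply: chain_glue => //=.
have : chain c [:: x; y].
  by elim: s h => // p s IHs; rewrite cat_cons => /chain_behead.
by rewrite /= xyz yz !andbT.
Qed.

Lemma chain_lt c x s y : chain c (x :: s) -> y \in s -> lt x y.
Proof.
elim: s x => // z s IHs x /= /andP[/andP[xz _]] zs; rewrite inE => /orP[/eqP -> //|ys].
exact: lt_tr xz (IHs _ zs ys).
Qed.

Lemma chain_nth_lt c x0 s i j : chain c s -> i < j -> j < size s ->
  lt (nth x0 s i) (nth x0 s j).
Proof.
elim: s i j => // x s IHs [|i] [|j] // h ij js; last exact: (IHs i j (chain_behead h)).
by rewrite /=; apply: (chain_lt h); rewrite mem_nth.
Qed.

Lemma chain_rcons_lt c s x y : chain c (rcons s x) -> y \in s -> lt y x.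
Proof.
elim: s => // z s IHs; rewrite rcons_cons => h; rewrite inE => /orP[/eqP ->|].
  by apply: (chain_lt h); rewrite mem_rcons mem_head.
exact: IHs (chain_behead h).
Qed.

Lemma avoids2_card c (A : {set T}) : avoids c 2 A -> #|A| <= 1.
Proof.
move=> cA; rewrite leqNgt; apply/card_gt1P => -[x [y [xA yA xy]]].
have [] := orP (lt_total xy) => h.
- have := cA [:: x; y] erefl; rewrite /= h /=; suff: {subset [:: x; y] <= A} by move=> s /(_ s).
  by move=> z; rewrite !inE => /orP[] /eqP ->.
- have := cA [:: y; x] erefl; rewrite /= h /=; suff: {subset [:: y; x] <= A} by move=> s /(_ s).
  by move=> z; rewrite !inE => /orP[] /eqP ->.
Qed.

(** The Erdos-Szekeres argument. In the step for a + 1 and b + 1, [E] collects the last points of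
    chains of a + 2 points. Its complement in [A] has no such chain, [E] has no opposite chain of b
    + 2 points, and Pascal's rule adds the two bounds. *)
Lemma cups_caps c a b (A : {set T}) :
  avoids c a.+2 A -> avoids (anti c) b.+2 A -> #|A| <= 'C(a + b, a).
Proof.
move: {2}(a + b) (leqnn (a + b)) => m; elim: m a b A => [|m IHm] a b A.
  by rewrite leqn0 addn_eq0 => /andP[/eqP -> /eqP ->] /avoids2_card.
case: a => [_ /avoids2_card|a]; first by rewrite bin0.
case: b => [_ _ /avoids2_card|b abm cA dA]; first by rewrite addn0 binn.
pose ends v := [exists s : a.+1.-tuple T, all [in A] s && chain c (rcons s v)].
pose E := [set v in A | ends v].
have EA : E \subset A by apply/subsetP => v; rewrite inE => /andP[].
rewrite -(cardsID E A) (setIidPr EA) addSn binS.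
apply: leq_add.
  rewrite -addSnnS; apply: IHm; first by lia.
    exact: avoidsS cA.
  move=> [//|v s] /= [sb] sE; apply/negP => vs.
  have /sE : v \in v :: s by rewrite mem_head.
  rewrite inE => /andP[vA /existsP[t /andP[tA tv]]].
  case/lastP E't : (tval t) (size_tuple t) tA tv => [//|t' u] st tA tv.
  have uv : lt u v by apply: (chain_rcons_lt tv); rewrite mem_rcons mem_head.
  case: s sb sE vs => [//|w s] sb sE vs.
  (* The triple [u], [v], [w] prolongs either the chain ending in [v] or the opposite chain starting
     there, and the result is too long. *)
  have [uvw|uvw] := boolP (c u v w).
    have vw : lt v w by case/andP: vs => /andP[].
    have := cA (rcons (rcons (rcons t' u) v) w).
    rewrite !size_rcons in st *; rewrite chain_rcons2 // st => /(_ erefl).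
    suff h : {subset rcons (rcons (rcons t' u) v) w <= A} by move/(_ h).
    move=> z; rewrite mem_rcons inE => /orP[/eqP -> |].
      by apply: (subsetP EA); apply: sE; rewrite !inE eqxx orbT.
    rewrite mem_rcons inE => /orP[/eqP -> //|]; exact: (allP tA).
  have := dA [:: u, v, w & s]; rewrite /= -sb => /(_ erefl).
  suff h : {subset [:: u, v, w & s] <= A}.
    by move/(_ h); move: vs => /= ->; rewrite uv /anti uvw.
  move=> z; rewrite inE => /orP[/eqP ->|/sE /(subsetP EA) //].
  by apply: (allP tA); rewrite mem_rcons mem_head.
apply: IHm; first by lia.
  case=> [//|x0 s0]; move: (x0 :: s0) => {x0 s0} s.
  case/lastP: s => [//|s v]; rewrite size_rcons => -[sa] sA; apply/negP => vs.
  have : v \in A :\: E by apply: sA; rewrite mem_rcons mem_head.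
  rewrite !inE => /andP[/negP vE vA]; apply: vE; rewrite vA.
  apply/existsP; exists (tcast sa (in_tuple s)).
  rewrite val_tcast /= vs andbT; apply/allP => z zs.
  by have : z \in A :\: E by [apply: sA; rewrite mem_rcons inE zs orbT]; rewrite inE => /andP[].
by apply: avoidsS dA; rewrite subsetDl.
Qed.


(* Along i < j < k < l, the four values below change at most once: no two equal
   ones enclose a different one. *)
Variable up : T -> T -> T -> bool.
Hypothesis up_signotope : forall i j k l, lt i j -> lt j k -> lt k l ->
  [/\ up i j k = up i k l -> up i j l = up i j k,
      up i j k = up j k l -> up i j l = up i j k,
      up i j k = up j k l -> up i k l = up i j k &
      up i j l = up j k l -> up i k l = up i j l].

Lemma chain_head2 x y s z : chain up [:: x, y & s] -> z \in s -> up x y z.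
Proof.
elim: s x y => // w s IHs x y h; rewrite inE => /orP[/eqP -> |zs].
  by move: h => /= /andP[/andP[]].
have yw := IHs _ _ (chain_behead h) zs.
have wz : lt w z := chain_lt (chain_behead (chain_behead h)) zs.
move: h => /= /andP[/andP[xy xyw] /andP[/andP[yw' _] _]].
by have [_ -> //] := up_signotope xy yw' wz; rewrite yw.
Qed.

Lemma chain_skip x y s : chain up [:: x, y & s] -> chain up (x :: s).
Proof.
case: s => // z s h; have xz : lt x z by apply: (chain_lt h); rewrite !inE eqxx orbT.
have := chain_behead (chain_behead h).
case: s h => [|w s] h /=; first by rewrite xz.
move=> h'; rewrite xz h' andbT; case/andP: h' => /andP[zw _] _.
have /= /andP[/andP[yz yzw] _] := chain_behead h.
move: h => /= /andP[/andP[xy xyz] _].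
by have [_ _ -> //] := up_signotope xy yz zw; rewrite xyz yzw.
Qed.

(** The points between the first two indices are deleted one by one with [chain_skip]; [chain_head2]
    then reaches any third point. *)
Lemma chain_nth x0 s i j k : chain up s -> i < j -> j < k -> k < size s ->
  up (nth x0 s i) (nth x0 s j) (nth x0 s k).
Proof.
elim: s i j k => // x s IHs [|i] [|j] [|k] // h; last first.
  by move=> ij jk ks; exact: (IHs i j k (chain_behead h)).
move=> _; elim: s j k {IHs} h => // y s IHs [|j] [|k] // h jk ks.
  by rewrite /=; apply: (chain_head2 h); rewrite mem_nth.
exact: (IHs j k (chain_skip h)).
Qed.

Hypothesis up_cyc : forall x y z, up x y z = up y z x.
Hypothesis up_swap : forall x y z, lt x y -> lt y z -> up x z y = ~~ up x y z.

(* A point beyond the chord of a cup sees every edge and diagonal of the cup on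
   the same side as the cup itself does. *)
Lemma chain_above x0 p s q z : chain up (p :: rcons s q) -> lt p z -> lt z q ->
  ~~ up p z q -> forall i j, i < j -> j < size (p :: rcons s q) ->
  up (nth x0 (p :: rcons s q) i) (nth x0 (p :: rcons s q) j) z.
Proof.
move=> h pz zq pzq.
set P := nth x0 _; set m := size s.
have Pm : P m.+1 = q by rewrite /P /= nth_rcons ltnn eqxx.
have sP : size (p :: rcons s q) = m.+2 by rewrite /= size_rcons.
have trip i j k : i < j -> j < k -> k < m.+2 -> up (P i) (P j) (P k).
  by move=> *; apply: chain_nth; rewrite ?sP.
have ltP i j : i < j -> j < m.+2 -> lt (P i) (P j).
  by move=> *; apply: (chain_nth_lt _ h); rewrite ?sP.
have P0 : P 0 = p by [].
clearbody P.
have Pz i : i < m.+2 -> P i != z.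
  move=> im; apply: contraNneq pzq => zi.
  have i0 : 0 < i by case: i zi {im} => // zi; move: pz; rewrite -zi P0 lt_irr.
  rewrite -zi -P0 -Pm; apply: trip => //.
  by rewrite ltn_neqAle -ltnS im andbT; apply: contraTneq zq => ei; rewrite -zi ei Pm lt_irr.
(* Among the four triples of [p], [P i], [z], [q], the middle two have different values, since
   [up p (P i) q] holds and [up p z q] fails. This is the only change, so the outer two are
   determined. *)
have inner i : 0 < i -> i < m.+1 ->
    if lt (P i) z then up p (P i) z && ~~ up (P i) z q
    else ~~ up p z (P i) && up z (P i) q.
  move=> i0 im; have pi : lt p (P i) by rewrite -P0; exact: ltP (leqW im).
  have iq : lt (P i) q by rewrite -Pm; exact: ltP.
  have piq : up p (P i) q by rewrite -P0 -Pm; exact: trip.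
  case: ifPn => iz.
    have [h1 _ _ h4] := up_signotope pi iz zq.
    move: h1 h4; rewrite piq (negbTE pzq); case: (up p _ z); case: (up _ z q) => //=; by [move=> /(_ erefl)|move=> _ /(_ erefl)].
  have zi : lt z (P i) by have := lt_total (Pz i (ltnW im)); rewrite (negbTE iz).
  have [h1 _ _ h4] := up_signotope pz zi iq.
  move: h1 h4; rewrite piq (negbTE pzq); case: (up p z _); case: (up z _ q) => //=; by [move=> /(_ erefl)|move=> _ /(_ erefl)].
have zcmp i : i < m.+2 -> lt (P i) z || lt z (P i) by move=> im; apply: lt_total; apply: Pz.
have zle i : 0 < i -> i < m.+1 -> lt (P i) z = false -> lt z (P i).
  by move=> i0 im e; have := zcmp i (ltnW im); rewrite e.
move=> i j ij; rewrite sP => jm; have j0 : 0 < j := leq_ltn_trans (leq0n _) ij.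
have [i0|i0] := posnP i.
  rewrite i0 P0; have [jm'|jm'] := ltnP j m.+1.
    have := inner j j0 jm'; case: ifPn => [_ /andP[] //|jz /andP[h1 _]].
    by rewrite up_swap // zle //; exact: negbTE.
  have -> : j = m.+1 by apply/eqP; rewrite eqn_leq jm' -ltnS jm.
  by rewrite Pm up_swap.
have im : i < m.+1 by exact: leq_trans ij jm.
have := inner i i0 im.
have [jm'|jm'] := ltnP j m.+1; last first.
  have -> : j = m.+1 by apply/eqP; rewrite eqn_leq jm' -ltnS jm.
  rewrite Pm; case: ifPn => [iz /andP[_ h1]|_ /andP[_]]; last by rewrite up_cyc.
  by rewrite up_swap.
have := inner j j0 jm'.
have pij : up p (P i) (P j) by rewrite -P0; exact: trip.
have ijq : up (P i) (P j) q by rewrite -Pm; exact: trip.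
have lij : lt (P i) (P j) by exact: ltP.
have ljq : lt (P j) q by rewrite -Pm; exact: ltP.
(* Three positions of [z] remain: after [P j], between [P i] and [P j], before [P i]. The first two
   are compared with [q], the last with [p]. *)
case: ifPn => jz.
  have iz : lt (P i) z by exact: lt_tr lij jz.
  rewrite iz => _ /andP[_ izq].
  have [h1 _ _ _] := up_signotope lij jz zq.
  by move: h1; rewrite ijq (negbTE izq); case: (up _ _ z) => // /(_ erefl).
have zj : lt z (P j) by apply: zle => //; exact: negbTE.
case: ifPn => iz /andP[h1 h2] /andP[h3 h4].
  rewrite up_swap //; have [e _ _ _] := up_signotope iz zj ljq.
  by move: e; rewrite ijq (negbTE h4); case: (up _ z _) => // /(_ erefl).
have zi : lt z (P i) by apply: zle => //; exact: negbTE.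
rewrite -up_cyc; have [_ _ _ e] := up_signotope pz zi lij.
by move: e; rewrite pij (negbTE h1); case: (up z _ _) => // /(_ erefl).
Qed.

Lemma exists_max (A : {set T}) x0 : x0 \in A ->
  exists2 v, v \in A & forall u, u \in A -> u != v -> lt u v.
Proof.
move=> x0A; case: (@arg_maxnP _ x0 (mem A) (fun v => #|[set u | lt u v]|) x0A) => v vA vmax.
exists v => // u uA uv; have := lt_total uv => /orP[//|vu].
have := vmax u uA; rewrite /geq /= leqNgt => /negP[]; apply: proper_card; apply/properP; split.
  by apply/subsetP => z; rewrite !inE => /lt_tr; apply.
by exists v; rewrite inE ?lt_irr.
Qed.

(** Recursion on the greatest element [v]: it joins [G] unless it completes a chain of m + 1 points.
    Being greatest, it can only be the last point of a chain, so earlier choices stay valid. *)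
Lemma greedy_split m : exists H : {set T}, avoids up m.+1 (~: H) /\
  forall v, v \in H -> exists t, [/\ size t = m, {subset t <= ~: H} & chain up (rcons t v)].
Proof.
suff: forall A : {set T}, exists G : {set T}, [/\ G \subset A, avoids up m.+1 G &
    forall v, v \in A -> v \notin G ->
    exists t, [/\ size t = m, {subset t <= G} & chain up (rcons t v)]].
  move=> /(_ setT)[G [_ avG cG]]; exists (~: G); rewrite setCK; split => // v.
  by rewrite inE => vG; apply: cG; rewrite ?inE.
move=> A; have [a aA] := ubnP #|A|; elim: a A aA => // a IHa A aA.
have [->|[x0 x0A]] := set_0Vmem A.
  exists set0; rewrite sub0set; split => // [[//|x s] _ /(_ x)|v]; last by rewrite inE.
  by rewrite mem_head inE => /(_ erefl).
have [v vA vmax] := exists_max x0A.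
have [|G [GA avG cG]] := IHa (A :\ v); first by move: aA; rewrite (cardsD1 v A) vA.
have ltGv u : u \in G -> lt u v.
  by move=> /(subsetP GA); rewrite !inE => /andP[uv uA]; apply: vmax.
have [/existsP[t /andP[tG tv]]|nv] :=
    boolP [exists t : m.-tuple T, all [in G] t && chain up (rcons t v)].
  exists G; split => //; first by apply: subset_trans GA (subD1set _ _).
  move=> u uA uG; have [-> | uv] := eqVneq u v; last by apply: cG; rewrite // !inE uv.
  by exists t; rewrite size_tuple; split => // z; apply: (allP tG).
exists (v |: G); split.
- by rewrite subUset sub1set vA (subset_trans GA (subD1set _ _)).
- move=> s; case/lastP: s => // s u; rewrite size_rcons => -[sm] sG.
  apply: contraNN nv => su.
  have us z : z \in s -> lt z u := chain_rcons_lt su.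
  have uG : u \in v |: G by apply: sG; rewrite mem_rcons mem_head.
  have sG' z : z \in s -> z \in G.
    move=> zs; have : z \in v |: G by apply: sG; rewrite mem_rcons inE zs orbT.
    rewrite in_setU1 => /orP[/eqP zv|//]; have := us z zs; rewrite zv => vu.
    move: uG; rewrite in_setU1 => /orP[/eqP uv|/ltGv uv]; first by rewrite uv lt_irr in vu.
    by have := lt_tr vu uv; rewrite lt_irr.
  move: uG; rewrite in_setU1 => /orP[/eqP uv|uG].
    apply/existsP; exists (tcast sm (in_tuple s)); rewrite val_tcast /= -uv su andbT.
    by apply/allP.
  have h : {subset rcons s u <= G}.
    by move=> z; rewrite mem_rcons inE => /orP[/eqP -> //|/sG'].
  by have := avG (rcons s u); rewrite size_rcons sm su => /(_ erefl h).
- move=> u uA; rewrite in_setU1 negb_or => /andP[uv uG].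
  have [|t [tm tG tu]] := cG u _ uG; first by rewrite !inE uv.
  by exists t; split => // z /tG zG; rewrite in_setU1 zG orbT.
Qed.

(** * The counting argument, with n = k + 6 *)

Variable k : nat.
Hypotheses (no_cup : avoids up k.+4.+2 setT) (no_cap : avoids (anti up) k.+4.+1 setT).
Hypothesis no_lens : forall p s q z, size s = k.+3 ->
  chain up (p :: rcons s q) -> lt p z -> lt z q -> up p z q.

Lemma noncup s : size s = k.+4.+2 -> chain up s -> False.
Proof. by move=> sk us; have /negP := no_cup sk (fun x _ => in_setT x); apply. Qed.

Lemma noncap s : size s = k.+4.+1 -> chain (anti up) s -> False.
Proof. by move=> sk us; have /negP := no_cap sk (fun x _ => in_setT x); apply. Qed.

(** A cup of n - 1 points cannot be prolonged, so its last edge forms a cap with every later point.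
    Its penultimate point thus extends any cap starting at [v] to the left. *)
Lemma cap_extends t v : size t = k.+4 -> chain up (rcons t v) ->
  exists2 u, lt u v & forall z, lt v z -> ~~ up u v z.
Proof.
case/lastP: t => // t u; rewrite size_rcons => -[tk] tv.
exists u; first by apply: (chain_rcons_lt tv); rewrite mem_rcons mem_head.
move=> w vw; apply/negP => uvw.
by apply: (@noncup (rcons (rcons (rcons t u) v) w)); [rewrite !size_rcons tk|exact: chain_rcons2].
Qed.

(* Let d1, d2, d3, ... be the cup completed by a2.  It starts after a1, and both
   d1 and d2 lie on the side of the line b a1 opposite to a2.  So d2 is above the
   line a1 a2, hence above the line a2 a3, and d1, d2, a2, a3, ... is too long a
   cup. *)
Lemma no_cap_into_cup (H : {set T}) a1 a2 s B b :
  (forall v, v \in H ->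
    exists t, [/\ size t = k.+4, {subset t <= ~: H} & chain up (rcons t v)]) ->
  a1 \in H -> a2 \in H -> size s = k.+3 -> chain up [:: a1, a2 & s] ->
  {subset rcons B b <= H} -> size B = k ->
  ~~ chain (anti up) (rcons (rcons B b) a1).
Proof.
move=> covH a1H a2H sk cupa BH Bk; apply/negP => capB.
(* The first point of the cap is in [H], so [cap_extends] prolongs it to the left, to k + 3 = n - 3
   points. *)
have [u capu] : exists u, chain (anti up) (u :: rcons (rcons B b) a1).
  case E : (rcons B b) BH capB => [|b1 B1]; first by case: (B) E.
  move=> BH capB; have b1H : b1 \in H by apply: BH; rewrite mem_head.
  have [t [tk _ tb]] := covH _ b1H.
  have [u ub capu] := cap_extends tk tb; exists u.
  have lt2 x : x \in rcons B1 a1 -> lt b1 x by exact: chain_lt capB.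
  move: capB lt2; rewrite !rcons_cons; case: (rcons B1 a1) => [|c s1] capB lt2.
    by rewrite /= ub.
  have h := capu c (lt2 c (mem_head _ _)); rewrite [chain _ _]/= in capB.
  by rewrite [chain _ _]/= ub /anti h /=.
have ba1 : lt b a1 by apply: (chain_rcons_lt capB); rewrite mem_rcons mem_head.
(* Otherwise y and z prolong the cap u, B, b, a1 to one of n-1 points. *)
have key y z : lt a1 y -> lt y z -> ~~ up a1 y z -> up b a1 y.
  move=> a1y yz a1yz; apply/negPn/negP => ba1y.
  apply: (@noncap ((u :: B) ++ [:: b; a1; y; z])).
    by rewrite /= size_cat /= Bk addn4.
  apply: chain_glue; last by rewrite /= /anti ba1 a1y yz a1yz ba1y.
  by move: capu; rewrite -!cats1 -catA.
have [t [tk tH tcup]] := covH _ a2H.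
case: t tk tH tcup => [|d1 [|d2 [|d3 t]]] // [tk] tH cupd.
have a12 : lt a1 a2 by apply: (chain_lt cupa); rewrite mem_head.
have d1a2 : lt d1 a2 by apply: (chain_rcons_lt cupd); rewrite mem_head.
have d2a2 : lt d2 a2 by apply: (chain_rcons_lt cupd); rewrite !inE eqxx orbT.
have /= /and3P[/andP[d12 u123] /andP[d23 _] _] := cupd.
have d1a1 : d1 != a1.
  by apply: contraTneq (tH d1 (mem_head _ _)) => ->; rewrite inE a1H.
(* Otherwise [no_lens], applied to the cup from [d1] to [a2], makes [d1] prolong the cup starting
   with [a1], [a2] to n points. *)
have a1d1 : lt a1 d1.
  have /orP[d1a1'|//] := lt_total d1a1; exfalso.
  have h : up d1 a1 a2 by apply: (@no_lens d1 [:: d2, d3 & t] a2) => //=; rewrite tk.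
  apply: (@noncup [:: d1, a1, a2 & s]); first by rewrite /= sk.
  by rewrite [chain _ _]/= d1a1' h /=; move: cupa.
have a1d2 := lt_tr a1d1 d12.
have a1d12 : ~~ up a1 d1 d2.
  apply/negP => h; apply: (@noncup [:: a1, d1, d2, d3 & rcons t a2]).
    by rewrite /= size_rcons tk.
  by move: cupd => /=; rewrite a1d1 h.
have ba1a2 : ~~ up b a1 a2.
  apply/negP => h; apply: (@noncup [:: b, a1, a2 & s]); first by rewrite /= sk.
  by move: cupa => /=; rewrite ba1 h.
have below y : lt a1 y -> lt y a2 -> up b a1 y -> ~~ up a1 y a2.
  move=> a1y ya2 h; have [_ e _ _] := up_signotope ba1 a1y ya2.
  by apply: contraNN ba1a2 => h'; rewrite e ?h ?h'.
have a1d1a2 := below _ a1d1 d1a2 (key _ _ a1d1 d12 a1d12).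
(* Otherwise replacing [d1] by [a1] gives another cup of n - 1 points, and [d1] lies beyond its
   chord from [a1] to [a2]. *)
have a1d23 : ~~ up a1 d2 d3.
  apply: contraNN a1d1a2 => h; apply: (@no_lens a1 [:: d2, d3 & t] a2) => //=.
    by rewrite tk.
  by move: cupd => /=; rewrite a1d2 h => /andP[_].
have a1d2a2 := below _ a1d2 d2a2 (key _ _ a1d2 d23 a1d23).
have d12a2 : up d1 d2 a2 by apply: (chain_head2 cupd); rewrite !inE mem_rcons mem_head orbT.
case: s sk cupa => // a3 s [sk] cupa.
have /= /and3P[/andP[_ a123] /andP[a23 _] _] := cupa.
have d2a23 : ~~ up d2 a2 a3.
  apply/negP => h; apply: (@noncup [:: d1, d2, a2, a3 & s]); first by rewrite /= sk.
  by move: cupa => /=; rewrite d12 d12a2 d2a2 h => /andP[_].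
have [_ _ e _] := up_signotope a1d2 d2a2 a23.
by move: e; rewrite a123 (negbTE a1d2a2) (negbTE d2a23) => /(_ erefl).
Qed.

Lemma card_bound :
  #|T| <= 'C(2 * k + 6, k + 3) + 'C(2 * k + 5, k + 3) + 'C(2 * k + 4, k).
Proof.
have [H [avG covH]] := greedy_split k.+4.
pose H1 := [set v in H | [exists s : k.+4.-tuple T, all [in H] s && chain up (v :: s)]].
have H1H : H1 \subset H by apply/subsetP => v; rewrite inE => /andP[].
have avH : avoids (anti up) k.+4 H.
  move=> [//|v [//|w s]] sk sH; apply/negP => h.
  have [t [tk _ tv]] := covH v (sH v (mem_head _ _)).
  have [u uv capu] := cap_extends tk tv.
  have vw : lt v w by apply: (chain_lt h); rewrite mem_head.
  apply: (@noncap [:: u, v, w & s]); first by rewrite /= -sk.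
  by move: h => /= ->; rewrite uv /anti capu.
rewrite -cardsT -(cardsID H setT) setTI setTD -(cardsID H1 H) (setIidPr H1H).
rewrite addnC -addnA; apply: leq_add; last rewrite addnC; last apply: leq_add.
- have -> : 2 * k + 6 = k.+3 + k.+3 by lia.
  rewrite addn3; apply: (@cups_caps up) => //.
  exact: avoidsS (subsetT _) no_cap.
(* A cup of n - 1 points inside [H] has its left end in [H1], so [H] without [H1] has no such cup,
   and no cap of n - 2 points. *)
- have -> : 2 * k + 5 = k.+3 + k.+2 by lia.
  rewrite addn3; apply: (@cups_caps up); last by apply: avoidsS avH; rewrite subsetDl.
  case=> // v s [sk] sH; apply/negP => h.
  have /sH : v \in v :: s by rewrite mem_head.
  rewrite !inE => /andP[/negP vH1 vH]; apply: vH1; rewrite vH.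
  apply/existsP; exists (tcast sk (in_tuple s)); rewrite val_tcast h andbT.
  by apply/allP => z zs; have := sH z; rewrite !inE zs orbT => /(_ erefl)/andP[].
(* Here the cups have fewer than k + 6 points and the caps fewer than k + 2; the binomial
   coefficient is used in its symmetric form. *)
- have -> : 2 * k + 4 = k + k.+4 by lia.
  rewrite -[X in 'C(_, X)](addnK k.+4 k) bin_sub ?leq_addl // addnC.
  apply: (@cups_caps up); first exact: avoidsS (subsetT _) no_cup.
  move=> s; case/lastP: s => // s a1; case/lastP: s => // B b.
  rewrite !size_rcons => -[Bk] sH.
  have : a1 \in H1 by apply: sH; rewrite mem_rcons mem_head.
  rewrite inE => /andP[a1H /existsP[[t tk] /= /andP[tH cupa]]].
  case: t tk tH cupa => [//|a2 t] /= tk /andP[a2H _] cupa.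
  apply: (no_cap_into_cup covH a1H a2H _ cupa) => //; first by move/eqP: tk => [].
  by move=> z zB; apply: (subsetP H1H); apply: sH; rewrite mem_rcons inE zB orbT.
Qed.

End Chains.

(** * Convex position in the plane *)

From mathcomp Require Import finmap interval_inference unstable.
From mathcomp Require Import boolp classical_sets convex.

Local Open Scope classical_set_scope.
Local Open Scope ring_scope.
Local Open Scope convex_scope.

Section Geometry.
Variable R : realType.
Implicit Types p q r x y z : plane R.

(** Twice the signed area of the triangle, positive for a counterclockwise turn. *)
Definition orient p q r : R :=
  (q 0 0 - p 0 0) * (r 0 1 - p 0 1) - (q 0 1 - p 0 1) * (r 0 0 - p 0 0).

Lemma orient_cyc p q r : orient p q r = orient q r p.
Proof. by rewrite /orient; ring. Qed.

Lemma orient_swap p q r : orient p r q = - orient p q r.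
Proof. by rewrite /orient; ring. Qed.

Lemma orientpp p q : orient p p q = 0.
Proof. by rewrite /orient; ring. Qed.

Lemma orientpqq p q : orient p q q = 0.
Proof. by rewrite /orient; ring. Qed.

Lemma orientpqp p q : orient p q p = 0.
Proof. by rewrite /orient; ring. Qed.

Lemma orient_conv p q (a b : convex_lmodType (plane R)) (t : {i01 R}) :
  orient p q (a <| t |> b) = t%:num * orient p q a + (1 - t%:num) * orient p q b.
Proof. by rewrite /orient /conv /= !mxE /onem; ring. Qed.

Lemma row2P p q : p 0 0 = q 0 0 -> p 0 1 = q 0 1 -> p = q.
Proof.
move=> h0 h1; apply/rowP => i.
by case: (unliftP 0 i) => [j ->|->] //; rewrite (ord1 j); move: h1; congr (_ = _); congr (_ _ _); apply/val_inj.
Qed.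

Lemma orient0_collinear p q r : p != q -> orient p q r = 0 -> collinear p q r.
Proof.
move=> pq h; exists p, (q - p); split; first by rewrite subr_eq0 eq_sym.
have h' : (q 0 0 - p 0 0) * (r 0 1 - p 0 1) = (q 0 1 - p 0 1) * (r 0 0 - p 0 0).
  by apply/eqP; rewrite -subr_eq0 -/(orient p q r) h.
split; first by exists 0; rewrite scale0r addr0.
  by exists 1; rewrite scale1r addrC subrK.
have [q0|q0] := eqVneq (q 0 0 - p 0 0) 0.
  have q1 : q 0 1 - p 0 1 != 0.
    apply: contra_neq pq => q1; apply: row2P; apply/eqP; rewrite eq_sym -subr_eq0; exact/eqP.
  have r0 : r 0 0 - p 0 0 = 0.
    by move: h'; rewrite q0 mul0r => /esym/eqP; rewrite mulf_eq0 (negbTE q1) => /eqP.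
  exists ((r 0 1 - p 0 1) / (q 0 1 - p 0 1)); apply: row2P; rewrite !mxE.
    by rewrite q0 mulr0 addr0; apply/eqP; rewrite -subr_eq0 r0.
  by rewrite divfK // addrC subrK.
exists ((r 0 0 - p 0 0) / (q 0 0 - p 0 0)); apply: row2P; rewrite !mxE.
  by rewrite divfK // addrC subrK.
by rewrite mulrAC [X in X / _]mulrC -h' mulrAC divff // mul1r addrC subrK.
Qed.

(** A point that is the unique minimum over [V] of an affine function is also its unique minimum
    over the hull, hence extreme. Conversely, an extreme point outside [V] could be removed from the
    hull. *)
Lemma convex_polygon_vertices (V : {fset plane R}) :
  (forall v, v \in V -> exists f : plane R -> R,
    (forall (a b : convex_lmodType (plane R)) (t : {i01 R}),
       f (a <| t |> b) = t%:num * f a + (1 - t%:num) * f b) /\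
    forall z, z \in V -> z != v -> f v < f z) ->
  vertices (convex_hull [set` V]) = [set` V].
Proof.
move=> exposed.
have hullV v : v \in V -> convex_hull [set` V] v.
  by move=> vV; move=> A [_ VA]; exact: VA.
apply/seteqP; split => [x [hx xext]|v /= vV].
  apply: contrapT => xV.
  (* Deleting an extreme point from the hull leaves a convex set. *)
  pose K := [set z | convex_hull [set` V] z /\ z <> x]%classic.
  suff : K x by case.
  apply: hx; split => [a b t|z /= zV]; last first.
    by split; [exact: hullV|move=> zx; apply: xV; rewrite -zx].
  rewrite !inE => -[ha ax] [hb bx].
  have [->|t0] := eqVneq t 0%:i01; first by rewrite conv0.
  have [->|t1] := eqVneq t 1%:i01; first by rewrite conv1.
  split.
    move=> A cA; have := cA.1 a b t; rewrite !inE; apply; [exact: ha|exact: hb].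
  move=> e; apply: ax; have [] := xext a b t ha hb _ _ (esym e) => //.
    by rewrite lt_neqAle eq_sym t0 ge0.
  by rewrite lt_neqAle t1 le1.
have [f [faff fmin]] := exposed v vV.
split; first exact: hullV.
have hullf z : convex_hull [set` V] z -> z = v \/ f v < f z.
  move=> hz; apply: (hz [set z | z = v \/ f v < f z]%classic); split; last first.
    by move=> y /= yV; have [->|yv] := eqVneq y v; [left|right; exact: fmin].
  move=> a b t; rewrite !inE /= => ha hb.
  have [->|t0] := eqVneq t 0%:i01; first by rewrite conv0.
  have [->|t1] := eqVneq t 1%:i01; first by rewrite conv1.
  have t0' : 0 < t%:num by rewrite lt_neqAle eq_sym t0 ge0.
  have t1' : t%:num < 1 by rewrite lt_neqAle t1 le1.
  case: ha => [->|fa]; case: hb => [->|fb].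
  - by left; rewrite convmm.
  - by right; rewrite faff; nra.
  - by right; rewrite faff; nra.
  - by right; rewrite faff; nra.
move=> a b t ha hb t0 t1 vab.
have fv : f v = t%:num * f a + (1 - t%:num) * f b by rewrite -faff -vab.
case: (hullf a ha) => [av|fa]; case: (hullf b hb) => [bv|fb] //.
- by move: fv; rewrite av => fv; exfalso; nra.
- by move: fv; rewrite bv => fv; exfalso; nra.
- by exfalso; nra.
Qed.

(** The factor [e] is 1 or -1 in the applications, so that caps and cups are treated together. *)
Definition turning (e : R) (s : seq (plane R)) :=
  forall i j k, (i < j)%N -> (j < k)%N -> (k < size s)%N ->
  0 < e * orient s`_i s`_j s`_k.

Lemma turning_gon (e : R) (s : seq (plane R)) (X : {fset plane R}) :
  (2 < size s)%N -> {subset s <= X} -> turning e s ->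
  contains_convex_gon (size s) X.
Proof.
move=> s2 sX ts.
(* Equal points make the orientation with any third point vanish; a third index is found between,
   before or after the two. *)
have ne i j : (i < j)%N -> (j < size s)%N -> s`_i != s`_j.
  move=> ij js; apply/negP => /eqP eij.
  have [ij1|ij1] := ltnP i.+1 j.
    by have := ts i i.+1 j (ltnSn i) ij1 js; rewrite eij orientpqp mulr0 ltxx.
  have [i0|i0] := posnP i.
    have j1 : j = 1%N by lia.
    subst i j; by have := ts 0%N 1%N 2%N isT isT s2; rewrite eij orientpp mulr0 ltxx.
  by have := ts 0%N i j i0 ij js; rewrite eij orientpqq mulr0 ltxx.
have us : uniq s.
  apply/(uniqP 0) => i j; rewrite !inE => il jl eij; apply/eqP; case: ltngtP => // ij.
    by have := ne i j ij jl; rewrite eij eqxx.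
  by have := ne j i ij il; rewrite eij eqxx.
pose V := [fset z in s]%fset.
have VE z : (z \in V) = (z \in s) by rewrite !inE.
have vV : vertices (convex_hull [set` V]) = [set` V].
  apply: convex_polygon_vertices => v; rewrite VE => vs.
  have /(nthP 0)[i il <-] := vs.
  pose n := size s.
  pose prv := if i is i'.+1 then i' else n.-1.
  pose nxt := if i.+1 == n then 0%N else i.+1.
  (* The sum of the two edge functionals at a vertex is minimal only there. *)
  exists (fun z => e * orient s`_prv s`_i z + e * orient s`_i s`_nxt z); split.
    by move=> a b t; rewrite !orient_conv; ring.
  move=> z; rewrite VE => /(nthP 0)[j jl <-] ji.
  have {}ji : j != i by apply: contraNneq ji => ->.
  rewrite orientpqq orientpqp !mulr0 addr0.
  have edge a : (a < n)%N -> let b := if a.+1 == n then 0%N else a.+1 in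
      forall j, (j < n)%N -> j != a -> j != b -> 0 < e * orient s`_a s`_b s`_j.
    move=> an b {ji} j {}jl ja; rewrite /b; have [an'|an'] := eqVneq a.+1 n => jb.
      by rewrite orient_cyc; apply: ts; lia.
    have [lt_ja|le_aj] := ltnP j a; last by apply: ts; lia.
    by rewrite orient_cyc orient_cyc; apply: ts; lia.
  have prvn : (prv < n)%N by rewrite /prv; move: il s2; rewrite -/n; case: (i); lia.
  have prvi : (if prv.+1 == n then 0%N else prv.+1) = i.
    by rewrite /prv; move: il s2; rewrite -/n; case: (i) => [|i']; case: ifP; lia.
  have := edge prv prvn j jl; rewrite prvi => /(_ _ ji) P.
  have := edge i il j jl ji; rewrite -/nxt => N.
  (* At a neighbour of the vertex one of the two terms vanishes; the other is positive because the
     two neighbours differ. *)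
  have [jp|jp] := eqVneq j prv; last first.
    apply: ltr_wpDr (P jp); have [->|/N/ltW //] := eqVneq j nxt.
    by rewrite orientpqq mulr0.
  rewrite jp orientpqp mulr0 add0r -jp; apply: N.
  by move: il s2 ji; rewrite jp /prv /nxt -/n; case: (i) => [|i']; case: ifP; lia.
exists (convex_hull [set` V]); split; last by rewrite vV => z /=; rewrite VE; exact: sX.
exists V; split => //.
by rewrite card_fseq undup_id.
Qed.

(** * Angular order around the lexicographically least point *)

Section LexMin.
Variable x : plane R.

Definition lexpos p :=
  0 < p 0 0 - x 0 0 \/ (p 0 0 - x 0 0 = 0 /\ 0 < p 0 1 - x 0 1).

Lemma orient_trans p q r : lexpos p -> lexpos q -> lexpos r ->
  0 < orient x p q -> 0 < orient x q r -> 0 < orient x p r.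
Proof.
rewrite /lexpos /orient.
move: (p 0 0 - x 0 0) (p 0 1 - x 0 1) (q 0 0 - x 0 0) (q 0 1 - x 0 1).
move: (r 0 0 - x 0 0) (r 0 1 - x 0 1) => f h a b c d hp hq hr pq qr.
(* The coordinates of q (p x r) = r (p x q) + p (q x r), for vectors based at [x] and their cross
   products. *)
have e0 : c * (a * h - b * f) = f * (a * d - b * c) + a * (c * h - d * f) by ring.
have e1 : d * (a * h - b * f) = h * (a * d - b * c) + b * (c * h - d * f) by ring.
rewrite ltNge; apply/negP => n.
by case: hp => [ap|[a0 bp]]; case: hq => [cp|[c0 dp]]; case: hr => [fp|[f0 hp]]; nra.
Qed.

End LexMin.

Lemma exists_lexmin (s : seq (plane R)) : s != [::] ->
  exists2 x, x \in s & forall y, y \in s -> y != x -> lexpos x y.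
Proof.
elim: s => // y [|z s] IHs _.
  by exists y; rewrite ?mem_head // => u; rewrite inE => ->.
have [//|x xs xmin] := IHs.
have [->|xy] := eqVneq y x.
  by exists x; rewrite ?mem_head // => u; rewrite inE => /orP[-> //|]; exact: xmin.
have lexpos_cases : lexpos x y \/ lexpos y x.
  rewrite /lexpos; have [h|h|h] := ltgtP (x 0 0) (y 0 0); [left; left; lra|right; left; lra|].
  have [h1|h1|h1] := ltgtP (x 0 1) (y 0 1).
  - left; right; lra.
  - right; right; lra.
  - by case/eqP: xy; exact: row2P.
case: lexpos_cases => h.
  exists x; first by rewrite inE xs orbT.
  by move=> u; rewrite inE => /orP[/eqP -> //|]; exact: xmin.
exists y; first exact: mem_head.
move=> u; rewrite inE => /orP[-> //|us _].
have [->//|ux] := eqVneq u x.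
by move: h (xmin u us ux); rewrite /lexpos => -[h|[h h']] -[h2|[h2 h2']]; [left|left|left|right]; lra.
Qed.
End Geometry.

(** Meant for the Grassmann-Pluecker relations among orientations, where the order around [x] makes
    the weights [p], [q], [r] positive. *)
Lemma sum_same_neg (R : realType) (u v w p q r : R) :
  0 < p -> 0 < q -> 0 < r -> u * p + v * q = w * r ->
  (u < 0) = (v < 0) -> (w < 0) = (u < 0).
Proof.
move=> p0 q0 r0 e uv; have [u0|u0] := boolP (u < 0).
  by move: uv; rewrite u0 => /esym v0; nra.
move: uv; rewrite (negbTE u0) => /esym/negbT; rewrite -leNgt => v0.
by rewrite -leNgt in u0; apply/negbTE; rewrite -leNgt; nra.
Qed.

(** * Planar sets in general position without a convex n-gon *)

Section PlanarBound.
Variables (R : realType) (k : nat) (X : {fset plane R}) (x : plane R).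
Hypotheses (genX : general_position X) (xX : x \in X)
  (xmin : forall y, y \in X -> y != x -> lexpos x y)
  (noX : ~ contains_convex_gon k.+4.+2 X).

Let T := (X `\ x)%fset.

Let lt (p q : T) := 0 < orient x (val p) (val q).

Let up (p q r : T) := orient (val p) (val q) (val r) < 0.

Let TX (p : T) : val p \in X.
Proof. by have := valP p; rewrite in_fsetD1 => /andP[]. Qed.

Let Tx (p : T) : val p != x.
Proof. by have := valP p; rewrite in_fsetD1 => /andP[]. Qed.

Let orient_neq0 (p q r : plane R) : p \in X -> q \in X -> r \in X ->
  p != q -> q != r -> p != r -> orient p q r != 0.
Proof.
move=> pX qX rX pq qr pr; apply/eqP => /(orient0_collinear pq).
exact: genX.
Qed.

Let lt_irr : irreflexive lt.
Proof. by move=> p; rewrite /lt orientpqq ltxx. Qed.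

Let lt_tr : transitive lt.
Proof. by move=> q p r; apply: orient_trans; exact: xmin (TX _) (Tx _). Qed.

Let lt_neq p q : lt p q -> p != q.
Proof. by apply: contraTneq => ->; rewrite lt_irr. Qed.

Let lt_total p q : p != q -> lt p q || lt q p.
Proof.
move=> pq; rewrite /lt (orient_swap _ (val p)) oppr_gt0 orbC -neq_lt.
by apply: orient_neq0; rewrite ?TX ?(eq_sym x).
Qed.

Let up_signotope i j m l : lt i j -> lt j m -> lt m l ->
  [/\ up i j m = up i m l -> up i j l = up i j m,
      up i j m = up j m l -> up i j l = up i j m,
      up i j m = up j m l -> up i m l = up i j m &
      up i j l = up j m l -> up i m l = up i j l].
Proof.
move=> ij jm ml; have im := lt_tr ij jm; have jl := lt_tr jm ml; have il := lt_tr ij jl.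
split.
- by apply: (sum_same_neg il ij im); rewrite /orient; ring.
- by apply: (sum_same_neg jl ij jm); rewrite /orient; ring.
- by apply: (sum_same_neg ml im jm); rewrite /orient; ring.
- by apply: (sum_same_neg ml il jl); rewrite /orient; ring.
Qed.

Let up_cyc p q r : up p q r = up q r p.
Proof. by rewrite /up orient_cyc. Qed.

(** General position excludes orientation 0, so a triple that is not a cup turns strictly the other
    way. *)
Let antiE p q r : lt p q -> lt q r -> anti up p q r = (0 < orient (val p) (val q) (val r)).
Proof.
move=> pq qr; rewrite /anti /up -leNgt lt_neqAle eq_sym orient_neq0 //.
- exact: lt_neq.
- exact: lt_neq.
- exact: lt_neq (lt_tr pq qr).
Qed.

Let up_swap p q r : lt p q -> lt q r -> up p r q = ~~ up p q r.
Proof. by move=> pq qr; rewrite -/(anti up p q r) antiE // /up orient_swap oppr_lt0. Qed.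

Let no_turning e s : size s = k.+4.+2 -> {subset s <= X} -> ~ turning e s.
Proof. by move=> sk sX ts; apply: noX; rewrite -sk; apply: turning_gon ts; rewrite ?sk. Qed.

Let sub_val (s : seq T) : {subset map val s <= X}.
Proof. by move=> _ /mapP[p _ ->]; exact: TX. Qed.

Let no_cup : avoids lt up k.+4.+2 [set: T]%SET.
Proof.
move=> [//|p s] sk _; apply/negP => us.
apply: (@no_turning (-1) (map val (p :: s))); [by rewrite size_map|exact: sub_val|].
move=> i j l ij jl; rewrite size_map => ls.
have js := ltn_trans jl ls; have i_s := ltn_trans ij js.
by rewrite !(nth_map p) // mulN1r oppr_gt0; apply: (chain_nth lt_tr up_signotope p us).
Qed.

Let no_cap : avoids lt (anti up) k.+4.+1 [set: T]%SET.
Proof.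
move=> [//|p s] sk _; apply/negP => us.
(* The signotope property is invariant under negation, so [chain_nth] also applies to caps. *)
have anti_signotope i j m l : lt i j -> lt j m -> lt m l ->
  [/\ anti up i j m = anti up i m l -> anti up i j l = anti up i j m,
      anti up i j m = anti up j m l -> anti up i j l = anti up i j m,
      anti up i j m = anti up j m l -> anti up i m l = anti up i j m &
      anti up i j l = anti up j m l -> anti up i m l = anti up i j l].
  move=> ij jm ml; have [h1 h2 h3 h4] := up_signotope ij jm ml; rewrite /anti.
  by split => /negb_inj e; congr negb; auto.
apply: (@no_turning 1 (x :: map val (p :: s))).
- by rewrite /= size_map; case: sk => ->.
- by move=> z; rewrite inE => /orP[/eqP -> //|]; exact: sub_val.
move=> i j l ij jl; rewrite [size _]/= size_map => ls; rewrite mul1r.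
case: j l ij jl ls => [|j] [|l] // ij jl ls; rewrite ![nth _ (x :: _) _.+1]/=.
have js : (j < size (p :: s))%N by exact: (@ltn_trans l j (size (p :: s)) jl ls).
have lt_jl : lt (nth p (p :: s) j) (nth p (p :: s) l).
  by apply: (chain_nth_lt lt_tr p us).
(* Triples starting at [x] are positively oriented by the definition of [lt]. *)
case: i ij => [|i] ij.
  by rewrite -[_ :: map _ _]/(map val (p :: s)) !(nth_map p).
have i_s : (i < size (p :: s))%N by exact: (@ltn_trans j i (size (p :: s)) ij js).
rewrite [nth _ (x :: _) _.+1]/= -[_ :: map _ _]/(map val (p :: s)) !(nth_map p) //.
have lt_ij : lt (nth p (p :: s) i) (nth p (p :: s) j).
  by apply: (chain_nth_lt lt_tr p us).
by rewrite -antiE //; apply: (chain_nth lt_tr anti_signotope p us).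
Qed.

Let no_lens p s q z : size s = k.+3 ->
  chain lt up (p :: rcons s q) -> lt p z -> lt z q -> up p z q.
Proof.
move=> sk us pz zq; apply/negPn/negP => pzq.
have above := chain_above lt_irr lt_tr lt_total up_signotope up_cyc up_swap p us pz zq pzq.
(* Placed after [q], the point [z] closes the polygon between [q] and [p]. *)
apply: (@no_turning (-1) (map val (rcons (p :: rcons s q) z))).
- by rewrite size_map !size_rcons /= size_rcons sk.
- exact: sub_val.
move=> i j l ij jl; rewrite size_map size_rcons => ls.
have js := ltn_trans jl ls; have i_s := ltn_trans ij js.
rewrite !(nth_map p) ?size_rcons //; move: ls; rewrite ltnS => ls.
rewrite mulN1r oppr_gt0 !nth_rcons (leq_trans jl ls) (leq_trans (ltn_trans ij jl) ls).
have [ll|ll|ll] := ltngtP l (size (p :: rcons s q)).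
- exact: (chain_nth lt_tr up_signotope p us).
- by move: ls; rewrite leqNgt ll.
- by apply: above => //; apply: leq_trans jl ls.
Qed.

Lemma card_no_gon_min :
  (#|` X| <= 'C(2 * k + 6, k + 3) + 'C(2 * k + 5, k + 3) + 'C(2 * k + 4, k) + 1)%N.
Proof.
rewrite (cardfsD1 x) xX add1n addn1 ltnS cardfE.
by have := card_bound lt_irr lt_tr lt_total up_signotope no_cup no_cap no_lens.
Qed.

End PlanarBound.

Lemma card_no_gon (R : realType) (k : nat) (X : {fset plane R}) :
  general_position X -> ~ contains_convex_gon k.+4.+2 X ->
  (#|` X| <= 'C(2 * k + 6, k + 3) + 'C(2 * k + 5, k + 3) + 'C(2 * k + 4, k) + 1)%N.
Proof.
move=> genX noX; have [->|X0] := eqVneq X fset0; first by rewrite cardfs0.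
have [|x xX xmin] := @exists_lexmin R (enum_fset X).
  apply: contraNneq X0 => e; rewrite -cardfs_eq0; by rewrite /= e.
exact: card_no_gon_min genX xX xmin noX.
Qed.

(** * Binomial estimates and the final bound *)

Lemma sum_bin_diag (M r : nat) :
  (\sum_(s < r.+1) 'C(M + s, s) = 'C(M + r.+1, r))%N.
Proof.
elim: r => [|r IHr]; first by rewrite big_ord_recl big_ord0 /= !bin0.
by rewrite big_ord_recr /= IHr [in RHS]addnS binS addnC.
Qed.

Lemma leq_bin_succ (N r : nat) : (2 * r < N)%N -> ('C(N, r) <= 'C(N, r.+1))%N.
Proof.
move=> rN; have := mul_bin_left N r; have : (r.+1 <= N - r)%N by lia.
by move: ('C(N, r)) ('C(N, r.+1)) => a b; nia.
Qed.

Lemma leq_binS (N r : nat) : (2 * r <= N.+1)%N -> ('C(N.+1, r) <= 2 * 'C(N, r))%N.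
Proof.
case: r => [|r] rN; first by rewrite !bin0.
by rewrite binS mul2n -addnn leq_add2l leq_bin_succ //; lia.
Qed.

(** After Pascal's rule cancels the terms of [w 4], the rest is at most 4 C(2k+2, k-1) for positive
    k. The weights of the other [w i] are at least 4, and the hockey-stick identity [sum_bin_diag]
    sums their binomial coefficients to C(2k+2, k-1). *)
Lemma bound_le_g k : ('C(2 * k + 5, k + 3) + 'C(2 * k + 4, k) <= g (k + 6) (k + 4))%N.
Proof.
(* The new index [s] is k + 4 - i. *)
have -> : (g (k + 6) (k + 4) = w 4 (k + 6) (k + 4) +
    \sum_(s < k) (k.+3 - s) * 'C(k.+2 + s, s))%N.
  rewrite /g big_ltn; last by lia.
  congr addn.
  rewrite -(add0n 5%N) big_addn big_rev_mkord /=.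
  have -> : ((k + 4).+1 - 5 - 0 = k)%N by lia.
  apply: eq_bigr => s _; have sk := ltn_ord s; rewrite /w.
  case: eqP => [|_]; first by lia.
  case: ltnP => [|_]; first by lia.
  by congr (_ * binomial _ _)%N; lia.
rewrite /w /=.
have -> : (k + 6 + (k + 4) - 6 = (2 * k + 3).+1)%N by lia.
have -> : (k + 4 - 2 = k.+2)%N by lia.
have -> : (k + 6 + (k + 4) - 7 = 2 * k + 3)%N by lia.
have -> : (k + 4 - 3 = k.+1)%N by lia.
have -> : (k + 6 + (k + 4) - 8 = 2 * k + 2)%N by lia.
have -> : (k + 4 - 4 = k)%N by lia.
have e1 : 'C(2 * k + 5, k + 3) = ('C((2 * k + 3).+1, k.+2) + 'C(2 * k + 3, k.+1) + 'C(2 * k + 3, k))%N.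
  have -> : (2 * k + 5 = (2 * k + 3).+2)%N by lia.
  rewrite -bin_sub; last by lia.
  have -> : ((2 * k + 3).+2 - (k + 3) = k.+2)%N by lia.
  by rewrite [LHS]binS -addnA; congr addn; rewrite binS.
rewrite {}e1; case: k => [|k]; first by rewrite big_ord0 !bin0.
have e2 : 'C(2 * k.+1 + 3, k.+1) = ('C(2 * k.+1 + 2, k.+1) + 'C(2 * k.+1 + 2, k))%N.
  by rewrite addnS binS.
have e3 : 'C(2 * k.+1 + 4, k.+1) = ('C(2 * k.+1 + 3, k.+1) + 'C(2 * k.+1 + 3, k))%N.
  by rewrite addnS binS.
have e4 : ('C(2 * k.+1 + 3, k) <= 2 * 'C(2 * k.+1 + 2, k))%N.
  by rewrite addnS leq_binS //; lia.
have e5 : (4 * 'C(2 * k.+1 + 2, k) <= \sum_(s < k.+1) (k.+4 - s) * 'C(k.+3 + s, s))%N.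
  have -> : (2 * k.+1 + 2 = k.+3 + k.+1)%N by lia.
  rewrite -sum_bin_diag big_distrr /=; apply: leq_sum => s _.
  by rewrite leq_mul2r; have := ltn_ord s; lia.
rewrite e3 e2; move: e4 e5 => {e2 e3}.
move: (\sum_(s < _) _)%N 'C(2 * k.+1 + 3, k) 'C(2 * k.+1 + 2, k) 'C(2 * k.+1 + 2, k.+1).
by move: 'C(_, k.+3) 'C(_, k.+2) => *; lia.
Qed.

Theorem theorem6 (R : realType) (n : nat) (hn : (6 <= n)%N) :
  exists fn : nat, is_f R n fn /\
    (fn <= 'C(2 * n - 6, n - 3) + g n (n - 2) + 2)%N.
Proof.
have [k nk] : exists k, n = k.+4.+2 by exists (n - 6)%N; lia.
pose B := ('C(2 * n - 6, n - 3) + g n (n - 2) + 2)%N.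
pose good N := (0 < N)%N && `[< forces_convex_gon R n N >].
(* A set without a convex n-gon has at most B - 1 points: one unit of the final 2 counts the point
   [x], the other passes to the next size. The least good number is then f(n). *)
have goodB : good B.
  rewrite /good /B addn2 /=; apply/asboolP => X XB genX; apply: contrapT => noX.
  rewrite nk in noX; have := card_no_gon genX noX; rewrite XB; apply/negP; rewrite -ltnNge.
  have := bound_le_g k; rewrite /B nk.
  have -> : (2 * k.+4.+2 - 6 = 2 * k + 6)%N by lia.
  have -> : (k.+4.+2 - 3 = k + 3)%N by lia.
  have -> : (k.+4.+2 - 2 = k + 4)%N by lia.
  have -> : (k.+4.+2 = k + 6)%N by lia.
  by lia.
have exg : exists N, good N by exists B.
case: (ex_minnP exg) => N /andP[N0 /asboolP NF] Nmin; exists N; split; last exact: Nmin.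
by split => // M M0 MF; apply: Nmin; rewrite /good M0; apply/asboolP.
Qed.
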